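(* Let $\lambda$ be an infinite cardinal, let $I$ be a set with $|I|=\lambda$, let $\mathcal{D}$ be an ultrafilter on $I$, and let $f : I \to \mathbb{N}$ be such that $\{ s \in I : n < f(s)\} \in \mathcal{D}$ for every $n \in \mathbb{N}$. If $\mathcal{D}$ is $\lambda$-regular below $f$, then $\left| \prod_{s \in I} 2^{f(s)} / \mathcal{D} \right| = 2^\lambda$.
   Context: For $f : I \to \mathbb{N}$, the ultrafilter $\mathcal{D}$ on $I$ is said to be $\lambda$-regular below $f$ if there are sets $X_\alpha \in \mathcal{D}$ for $\alpha < \lambda$ such that $|\{ \alpha < \lambda : t \in X_\alpha \}| \leq f(t)$ for every $t \in I$. Here $\prod_{s \in I} 2^{f(s)} / \mathcal{D}$ denotes the ultraproduct modulo $\mathcal{D}$ of the finite sets $\{0, 1, \dots, 2^{f(s)} - 1\}$, and $|\cdot|$ its cardinality. *)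

(* Defs.v *)
From mathcomp Require Import all_boot.
From mathcomp Require Import boolp classical_sets functions cardinality filter.

Set Implicit Arguments.
Unset Strict Implicit.
Unset Printing Implicit Defensive.

Local Open Scope classical_set_scope.
Local Open Scope card_scope.

(* A cardinal is represented by a type [L] of that cardinality, which also
   serves as the index set for the ordinals [alpha < lambda]: the order plays
   no role, so the choice of [L] within its equipotence class is immaterial. *)
Definition regular_below (L I : Type) (D : set_system I) (f : I -> nat) : Prop :=
  exists X : L -> set I,
    (forall a : L, D (X a)) /\
    (forall t : I, [set a : L | X a t] #<= `I_(f t)).

Definition eq_mod (I : Type) (D : set_system I) (A : I -> Type)
    (x y : forall s : I, A s) : Prop :=
  D [set s | x s = y s].

(* The quotient is the set of equivalence classes. *)
Definition ultraproduct (I : Type) (D : set_system I) (A : I -> Type) :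
    set (set (forall s : I, A s)) :=
  range (fun x : forall s : I, A s => [set y | eq_mod D x y]).
Arguments ultraproduct {I} D A.

(* [eq_mod] is an equivalence relation, so [ultraproduct] is a partition. *)
Lemma eq_mod_refl (I : Type) (D : set_system I) (FD : Filter D)
    (A : I -> Type) (x : forall s : I, A s) : eq_mod D x x.
Proof. by apply: filterS filterT => s _. Qed.

Lemma eq_mod_sym (I : Type) (D : set_system I) (FD : Filter D)
    (A : I -> Type) (x y : forall s : I, A s) : eq_mod D x y -> eq_mod D y x.
Proof. by apply: filterS => s /= ->. Qed.

Lemma eq_mod_trans (I : Type) (D : set_system I) (FD : Filter D)
    (A : I -> Type) (x y z : forall s : I, A s) :
  eq_mod D x y -> eq_mod D y z -> eq_mod D x z.
Proof. by apply: filterS2 => s /= -> ->. Qed.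

(* Main.v *)
Require Import Defs.
From mathcomp Require Import all_boot.
From mathcomp Require Import boolp classical_sets functions cardinality filter.

Local Open Scope classical_set_scope.
Local Open Scope card_scope.

(** Write [e_s] for an injection of the finite set [{a | s \in X_a}] into
  [{0, ..., f s - 1}]. A function [phi : L -> bool] induces at each [s] the
  bit string of length [f s] that stores [phi a] at position [e_s a]. If [phi]
  and [psi] differ at [a], their strings differ at every [s] in [X_a], which is
  [D]-large, so there are at least [2^lambda] classes. Conversely, an element of
  the product is determined by its graph, a subset of [I * nat], and
  [|I * nat| = lambda]. *)

Lemma injective_card_leT (T U : Type) (f : T -> U) :
  injective f -> [set: T] #<= [set: U].
Proof.
move=> f_inj; suff [h] : $|{injfun [set: T] >-> [set: U]}| by apply: inj_card_le h.
by apply/injfunPex; exists f => // x y _ _ /f_inj.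
Qed.

Lemma card_leT_injective (T U : Type) :
  [set: T] #<= [set: U] -> exists f : T -> U, injective f.
Proof.
move=> /card_leP[g]; exists (fun x => val (g (SigSub (mem_set (I : [set: T] x))))).
by move=> x y /val_inj /(inj (in_setT _) (in_setT _)) [].
Qed.

(** One condition does two jobs: for [g = h] it makes [g] injective, and for distinct [g] and [h] it
    makes their ranges disjoint. *)
Definition disjoint_sequences (T : Type) (F : set (nat -> T)) : Prop :=
  forall g h m n, F g -> F h -> g m = h n -> g = h /\ m = n.

(** By Zorn: if infinitely many points were left uncovered, an injective sequence [k] through them
    could be added to a maximal family. *)
Lemma maximal_disjoint_sequences (T : Type) :
  exists F : set (nat -> T), disjoint_sequences T F /\
    finite_set (~` [set x | exists g n, F g /\ g n = x]).
Proof.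
have [|F [FP Fmax]] := @Zorn_bigcup _ (disjoint_sequences T).
  move=> G GP Gtot g h m n [X GX Xg] [Y GY Yh].
  have [XY|YX] := Gtot _ _ GX GY.
    by apply: (GP _ GY) => //; apply: XY.
  by apply: (GP _ GX) => //; apply: YX.
exists F; split=> //; set C := [set x | _].
apply: contrapT => /infiniteP/card_leP[k0].
pose k n : T := val (k0 (SigSub (mem_set (I : [set: nat] n)))).
have kC n : ~ C (k n) by apply: set_mem (valP (k0 _)).
have k_inj : injective k.
  by move=> x y /val_inj /(inj (in_setT _) (in_setT _)) [].
have FgC g n : F g -> C (g n) by exists g, n.
apply: (Fmax (F `|` [set k])).
  split; first by move=> g; left.
  by move=> /(_ k (or_intror erefl)) /(FgC _ 0) /kC.
move=> g h m n [Fg|->] [Fh|->].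
- exact: FP.
- by move=> E; case: (kC n); rewrite -E; apply: FgC.
- by move=> E; case: (kC m); rewrite E; apply: FgC.
- by move=> /k_inj.
Qed.

(** Up to finitely many points, [T] splits into disjoint copies of [nat], and a further natural
    number can be coded inside each copy. *)
Lemma infinite_prod_nat_injective (T : Type) :
  infinite_set [set: T] -> exists h : T * nat -> T, injective h.
Proof.
move=> T_inf; have [F [FP]] := maximal_disjoint_sequences T.
set C := [set x | _] => C_fin.
have [g0 Fg0] : exists g, F g.
  apply: contrapT => F0; apply: T_inf; suff <- : ~` C = setT by [].
  by apply/seteqP; split=> // x _ [g [n [Fg _]]]; apply: F0; exists g.
have [r r_inj] : exists r : T -> nat, {in ~` C &, injective r}.
  exact/pcard_injP/finite_set_countable.
(* [true, n] marks [x] as the [n]-th term of its sequence; the finitely many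
   uncovered points are attached to [g0] with mark [false]. *)
have /choice[t tP] : forall x, exists t : (nat -> T) * (bool * nat),
    F t.1 /\ if t.2.1 then t.1 t.2.2 = x else ~ C x /\ t.2.2 = r x.
  move=> x; have [[g [n [Fg gx]]]|Cx] := EM (C x).
    by exists (g, (true, n)).
  by exists (g0, (false, r x)).
(* The image stays in the sequence assigned to [x]; its index codes the mark, the position and [m]
   together, so disjointness of the sequences recovers all of them. *)
exists (fun p => (t p.1).1 (pickle ((t p.1).2, p.2))) => -[x m] [y n] /= E.
have [Fx tx] := tP x; have [Fy ty] := tP y.
have [t1 /(pcan_inj pickleK) [t2 ->]] := FP _ _ _ _ Fx Fy E.
congr (_, _); move: tx ty; rewrite -t1 -t2.
case: (t x).2.1 => [-> //|[Cx ->] [Cy]].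
by apply: r_inj; apply/mem_set.
Qed.

Lemma card_prod_nat_le (I L : Type) (A : I -> Type)
    (enc : forall s, A s -> nat) :
  infinite_set [set: L] -> [set: I] #<= [set: L] ->
  (forall s, injective (enc s)) ->
  [set: forall s, A s] #<= [set: L -> bool].
Proof.
move=> L_inf /card_leT_injective[i i_inj] enc_inj.
have [h h_inj] := infinite_prod_nat_injective L L_inf.
(* This is the graph of [x], carried into [L] by the injection [(s, n) |-> h (i s, n)]. *)
pose graph (x : forall s, A s) l := `[< exists s, l = h (i s, enc s (x s)) >].
apply: (injective_card_leT _ _ graph) => x y xy; apply: functional_extensionality_dep => s.
have /asboolP[s' /h_inj[/i_inj ss']] : graph y (h (i s, enc s (x s))).
  by rewrite -xy; apply/asboolP; exists s.
by rewrite -ss' => /enc_inj.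
Qed.

Lemma ultraproduct_card_le (L I : Type) (D : set_system I) (f : I -> nat) :
  infinite_set [set: L] -> [set: I] #<= [set: L] ->
  ultraproduct D (fun s : I => 'I_(f s)) #<= [set: L -> bool].
Proof.
move=> L_inf IL; apply: card_le_trans (card_image_le _ _) _.
apply: (card_prod_nat_le I L _ (fun s => @nat_of_ord (f s))) => // s.
exact: ord_inj.
Qed.

Lemma bits_code_injective (n : nat) :
  exists c : {ffun 'I_n -> bool} -> 'I_(2 ^ n), injective c.
Proof.
have E : #|{ffun 'I_n -> bool}| = 2 ^ n by rewrite card_ffun card_bool card_ord.
by exists (fun u => cast_ord E (enum_rank u)) => u v /cast_ord_inj /enum_rank_inj.
Qed.

Lemma ultraproduct_card_ge (L I : Type) (D : set_system I) (f : I -> nat) :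
  ProperFilter D -> regular_below L D f ->
  [set: L -> bool] #<= ultraproduct D (fun s : I => 'I_(2 ^ f s)).
Proof.
move=> D_proper [X [DX X_fin]].
have /choice[e eP] : forall s, exists e : L -> nat,
    (forall a, X a s -> e a < f s) /\
    {in [set a | X a s] &, injective e}.
  move=> s; have /pcard_leP/injfunPex[e e_fun e_inj] := X_fin s.
  by exists e; split.
have [c c_inj] : exists c : forall s, {ffun 'I_(f s) -> bool} -> 'I_(2 ^ f s),
    forall s, injective (c s).
  pose c s := projT1 (cid (bits_code_injective (f s))).
  by exists c => s; apply: projT2 (cid (bits_code_injective (f s))).
(* Positions outside the image of [e s] hold the default bit [false]. *)
pose bits (phi : L -> bool) s : {ffun 'I_(f s) -> bool} :=
  [ffun i : 'I_(f s) => `[< exists a, [/\ X a s, e s a = i & phi a] >]].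
have bitsE phi s a (Xas : X a s) :
    bits phi s (Ordinal ((eP s).1 a Xas)) = phi a.
  rewrite ffunE; apply/asboolP/idP => /= [[b [Xbs ba]]|phia].
    by rewrite (_ : b = a) //; apply: (eP s).2 ba; apply/mem_set.
  by exists a.
pose x phi s := c s (bits phi s).
pose cl phi := [set y | eq_mod D (x phi) y].
have cl_inj : injective cl.
  move=> phi psi E; apply: functional_extensionality_dep => a.
  have : cl phi (x psi) by rewrite E; apply: eq_mod_refl.
  (* Since [D] is proper, [X a] meets the set where [x phi] and [x psi] agree; at such an [s] the
     bit stored for [a] gives [phi a = psi a]. *)
  move=> /(filterI (DX a)) /filter_ex[s [Xas /c_inj bE]].
  by rewrite -(bitsE phi s a Xas) bE bitsE.
have /card_eqPle[_ range_ge] : range cl #= [set: L -> bool].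
  by apply: inj_card_eq => phi psi _ _ /cl_inj.
apply: card_le_trans range_ge _; apply: subset_card_le => _ [phi _ <-].
by exists (x phi).
Qed.

Theorem claim4p2 (L I : Type) (D : set_system I) (f : I -> nat)
    (L_infinite : infinite_set [set: L])
    (card_I : [set: I] #= [set: L])
    (D_ultra : UltraFilter D)
    (f_unbounded : forall n : nat, D [set s | (n < f s)%N])
    (D_regular : regular_below L D f) :
  ultraproduct D (fun s : I => 'I_(2 ^ f s)%N) #= [set: L -> bool].
Proof.
apply/card_eqPle; split; last exact: ultraproduct_card_ge.
by apply: (ultraproduct_card_le L I D (fun s => 2 ^ f s)) => //; case/card_eqPle: card_I.
Qed.
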